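(* A partial Johnson graph $G$ has connected medians if and only if $G$ is meshed.
   Context: Graphs are undirected, connected, without loops or multiple edges, and not necessarily finite. $d$ is the standard graph distance of $G=(V,E)$. For a set $X$ and a positive integer $k$, the Johnson graph $J(X,k)$ has as vertices the subsets of $X$ of size $k$, two of them $A,B$ being adjacent iff $|A\triangle B|=2$. A subgraph $H$ of a graph $G'$ is isometric if $d_H(u,v)=d_{G'}(u,v)$ for all vertices $u,v$ of $H$. A partial Johnson graph is a graph that is (isomorphic to) an isometric subgraph of a Johnson graph. A graph $G$ is meshed if for any three vertices $u,v,w$ with $d(v,w)=2$ there exists a common neighbor $x$ of $v$ and $w$ such that $2d(u,x)\le d(u,v)+d(u,w)$. A profile is a map $\pi:V\to[0,\infty)$ with finite support, $F_\pi(x)=\sum_{u}\pi(u)d(u,x)$, and $\mathrm{Med}(\pi)$ is the set of vertices minimizing $F_\pi$. $G$ has connected medians if for every profile $\pi$ the set $\mathrm{Med}(\pi)$ induces a connected subgraph of $G$. *)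

(* Defs.v *)
From mathcomp Require Import all_boot all_order all_algebra finmap.
From mathcomp Require Import boolp classical_sets functions cardinality fsbigop.
From mathcomp Require Import reals.

Set Implicit Arguments.
Unset Strict Implicit.
Unset Printing Implicit Defensive.

Import Order.TTheory GRing.Theory Num.Theory.

Local Open Scope classical_set_scope.

(* Possibly infinite simple graphs. Connectedness is a separate predicate, since
   one has to speak of subgraphs that may fail to be connected. *)
Record graph := Graph {
  vertex :> choiceType;
  adj : rel vertex;
  adj_sym : symmetric adj;
  adj_irr : irreflexive adj }.

Arguments adj {g}.

Definition walk (G : graph) (u v : G) (p : seq G) : Prop :=
  path adj u p /\ last u p = v.

Definition connected (G : graph) : Prop := forall u v : G, exists p, walk u v p.

Definition walk_length (G : graph) (u v : G) (n : nat) : bool :=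
  `[< exists2 p, walk u v p & size p = n >].

(* The value is 0 when u and v lie in different components. *)
Definition dist (G : graph) (u v : G) : nat :=
  if pselect (exists n, walk_length u v n) is left uv then ex_minn uv else 0.

Record subgraph (G : graph) := Subgraph {
  sub_vertex : set G;
  sub_adj : rel sub_vertex;
  sub_adj_sym : symmetric sub_adj;
  sub_adj_irr : irreflexive sub_adj;
  sub_adjW : forall x y, sub_adj x y -> adj (val x) (val y) }.

Coercion graph_of_subgraph (G : graph) (H : subgraph G) : graph :=
  Graph (@sub_adj_sym G H) (@sub_adj_irr G H).

Section InducedSubgraph.
Variables (G : graph) (S : set G).

Definition induced_adj : rel S := fun x y => adj (val x) (val y).

Lemma induced_adj_sym : symmetric induced_adj.
Proof. by move=> x y; apply: adj_sym. Qed.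

Lemma induced_adj_irr : irreflexive induced_adj.
Proof. by move=> x; apply: adj_irr. Qed.

Definition induced : subgraph G :=
  @Subgraph G S induced_adj induced_adj_sym induced_adj_irr (fun _ _ xy => xy).

End InducedSubgraph.

Definition isometric (G : graph) (H : subgraph G) : Prop :=
  connected H /\ forall u v : H, dist u v = @dist G (val u) (val v).

Definition isomorphic (G H : graph) : Prop :=
  exists2 f : G -> H, bijective f & forall x y, adj (f x) (f y) = adj x y.

Section JohnsonGraph.
Variables (X : choiceType) (k : nat).

Definition johnson_adj : rel {A : {fset X} | #|` A| == k} := fun A B =>
  #|` ((val A `\` val B) `|` (val B `\` val A))%fset| == 2.

Lemma johnson_adj_sym : symmetric johnson_adj.
Proof. by move=> A B; rewrite /johnson_adj fsetUC. Qed.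

Lemma johnson_adj_irr : irreflexive johnson_adj.
Proof. by move=> A; rewrite /johnson_adj fsetDv fsetUid cardfs0. Qed.

Definition johnson : graph := Graph johnson_adj_sym johnson_adj_irr.

End JohnsonGraph.

Definition partial_johnson (G : graph) : Prop :=
  exists (X : choiceType) (k : nat) (H : subgraph (johnson X k)),
    [/\ 0 < k, isometric H & isomorphic G H].

Definition meshed (G : graph) : Prop :=
  forall u v w : G, dist v w = 2 ->
    exists x, [/\ adj v x, adj w x & 2 * dist u x <= dist u v + dist u w].

Section Medians.
Variables (R : realType) (G : graph).
Local Open Scope ring_scope.

Definition profile (pi : G -> R) : Prop :=
  (forall u, 0 <= pi u) /\ finite_set [set u | pi u != 0].

(* The sum over all vertices is a sum over the support of its summand, which is
   finite when pi is a profile. *)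
Definition F (pi : G -> R) (x : G) : R :=
  \sum_(u \in [set: G]) pi u * (dist u x)%:R.

Definition Med (pi : G -> R) : set G := [set x | forall y, F pi x <= F pi y].

Definition connected_medians : Prop :=
  forall pi, profile pi -> connected (induced (Med pi)).

End Medians.

(* Main.v *)
Require Import Defs.
From mathcomp Require Import all_boot all_order all_algebra reals.
From mathcomp Require Import finmap boolp classical_sets cardinality fsbigop.
From mathcomp Require Import zify lra.

(** Connected medians imply meshedness in every connected graph: if meshedness
    fails for u, v, w, then a profile concentrated on v and w, with a little
    mass on u, has exactly v and w as medians, and these are not adjacent
    ([connected_medians_meshed]).

    Conversely, the set of medians is connected as soon as F satisfies, for any
    v and w at distance two, F(x) + F(y) <= F(v) + F(w) for two common
    neighbours x and y of v and w. Indeed this local convexity yields, for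
    medians v and w at any distance, a median adjacent to v and closer to w
    ([F_convex_step], [balanced_connected_medians]). Summing over the profile,
    it is enough to find x and y with d(u,x) + d(u,y) <= d(u,v) + d(u,w) for all
    u at once, where meshedness only gives a common neighbour x, depending on u,
    with 2 d(u,x) <= d(u,v) + d(u,w).

    This uniform choice is where the embedding into a Johnson graph is used.
    The sets v and w are C + a + a' and C + b + b', and their common neighbours
    are among the four sets of the 4-cycle C + a + b, C + a + b', C + a' + b',
    C + a' + b. If two opposite ones are present, they satisfy the inequality
    with equality. If only one is present, it is the one that meshedness gives
    for every u. If exactly two adjacent ones are present, say those containing
    a, the inequality for them says that every vertex u containing a' also
    contains a; this follows from meshedness applied to further triples around a
    violating u ([adjacent_pair_exchange]), with the help of the triangle
    condition that holds in all meshed graphs ([meshed_triangle]). *)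

Set Implicit Arguments.
Unset Strict Implicit.
Unset Printing Implicit Defensive.

Import Order.TTheory GRing.Theory Num.Theory.

(** * Distances in connected and in meshed graphs *)

Section Distance.
Variable G : graph.
Implicit Types u v w x : G.

Lemma walk_cat u v w p q : walk u v p -> walk v w q -> walk u w (p ++ q).
Proof.
by move=> [pp <-] [qp <-]; split; rewrite ?cat_path ?pp // last_cat.
Qed.

Lemma dist_walk u v p : walk u v p -> dist u v <= size p.
Proof.
move=> uvp; rewrite /dist; case: pselect => [ex|[]]; last first.
  by exists (size p); apply/asboolP; exists p.
by case: ex_minnP => n _; apply; apply/asboolP; exists p.
Qed.

Lemma dist_refl u : dist u u = 0.
Proof. by apply/eqP; rewrite -leqn0; apply: (@dist_walk u u [::]). Qed.

(** The second condition makes f a lower bound for the length of any walk to v;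
    by the third one, a walk along which f keeps dropping reaches v in exactly
    f u steps. *)
Lemma dist_unique v (f : G -> nat) :
    (forall u, f u = 0 <-> u = v) ->
    (forall u x, adj u x -> f u <= (f x).+1) ->
    (forall u n, f u = n.+1 -> exists2 x, adj u x & f x = n) ->
  forall u, dist u v = f u.
Proof.
move=> f0 flip fdrop u.
have lower w p : walk w v p -> f w <= size p.
  elim: p w => [|x p IHp] w [/= wp wv]; first by rewrite (f0 w).2.
  case/andP: wp => wx xp; apply: leq_trans (flip _ _ wx) _.
  by rewrite ltnS IHp.
have upper : exists2 p, walk u v p & size p = f u.
  move: {2}(f u) (erefl (f u)) => n; elim: n u => [|n IHn] u fu.
    by exists [::] => //; split=> //=; apply/f0.
  have [x ux /[dup] fx /IHn [p [xp pv] sp]] := fdrop _ _ fu.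
  by exists (x :: p); rewrite /= ?sp ?fx ?fu //; split=> //=; rewrite ux.
have [p uvp sp] := upper.
rewrite /dist; case: pselect => [ex|[]]; last first.
  by exists (f u); apply/asboolP; exists p.
case: ex_minnP => n /asboolP [q uvq <-] min.
by apply/eqP; rewrite eqn_leq lower ?andbT // min //; apply/asboolP; exists p.
Qed.

Hypothesis Gconn : connected G.

Lemma dist_path u v : exists2 p, walk u v p & size p = dist u v.
Proof.
have [p uvp] := Gconn u v.
rewrite /dist; case: pselect => [ex|[]]; last first.
  by exists (size p); apply/asboolP; exists p.
by case: ex_minnP => n /asboolP [q uvq <-] _; exists q.
Qed.

Lemma dist_triangle v u w : dist u w <= dist u v + dist v w.
Proof.
have [p uvp <-] := dist_path u v; have [q vwq <-] := dist_path v w.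
by rewrite -size_cat; apply/dist_walk/walk_cat/vwq.
Qed.

Lemma dist_leC u v : dist u v <= dist v u.
Proof.
have [p [vp pu] <-] := dist_path v u.
have -> : size p = size (rev (belast v p)) by rewrite size_rev size_belast.
apply: dist_walk; rewrite -pu; split.
  by rewrite rev_path; under eq_path => x y do rewrite adj_sym.
by case: (p) => //= x q; rewrite rev_cons last_rcons.
Qed.

Lemma distC u v : dist u v = dist v u.
Proof. by apply/eqP; rewrite eqn_leq !dist_leC. Qed.

Lemma dist_eq0 u v : dist u v = 0 -> u = v.
Proof.
by have [p [_ pv] <-] := dist_path u v; case: p pv.
Qed.

Lemma adj_dist u v : adj u v = (dist u v == 1).
Proof.
apply/idP/eqP => [uv|]; last first.
  have [p [up <-] <-] := dist_path u v; case: p up => [|x [|]] //=.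
  by rewrite andbT.
apply/eqP; rewrite eqn_leq (@dist_walk u v [:: v]) ?lt0n /=; last first.
  by split=> //=; rewrite uv.
by apply/eqP => /dist_eq0 uv0; rewrite uv0 adj_irr in uv.
Qed.

Lemma dist_closer u v n : dist u v = n.+1 -> exists2 x, adj u x & dist x v = n.
Proof.
move=> uvn; have [[|x p] [/= up pv]] := dist_path u v; rewrite uvn // => -[sp].
case/andP: up => ux xp; exists x => //; have := dist_triangle x u v.
move: ux; rewrite adj_dist => /eqP ->; rewrite uvn ltnS => nx.
by apply/eqP; rewrite eqn_leq nx -{1}sp dist_walk.
Qed.

Lemma dist_adj u v : adj u v -> dist u v = 1 /\ dist v u = 1.
Proof. by rewrite [dist v u]distC adj_dist => /eqP ->. Qed.

(** The triangle condition, by induction on n. Let p be a neighbour of x at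
    distance n from u, and suppose that it is not adjacent to y. Meshedness
    gives a common neighbour z of p and y at distance n, and the induction
    hypothesis a common neighbour q of p and z at distance n - 1. As q is at
    distance two from both x and y, meshedness seen from x gives a common
    neighbour of q and y that is close enough to x to be adjacent to it. *)
Lemma meshed_triangle (Gmesh : meshed G) u x y n :
    adj x y -> dist u x = n.+1 -> dist u y = n.+1 ->
  exists z, [/\ adj x z, adj y z & dist u z = n].
Proof.
elim: n x y => [|n IHn] x y xy ux uy.
  by exists u; rewrite !adj_dist ![dist _ u]distC dist_refl ux uy.
have [p xp pu] : exists2 p, adj x p & dist p u = n.+1.
  by apply: dist_closer; rewrite distC.
have up : dist u p = n.+1 by rewrite distC.
have [yp|yp] := boolP (adj y p); first by exists p.
have py2 : dist p y = 2.
  have := dist_triangle x p y; have := dist_triangle p u y; move: yp.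
  by rewrite adj_dist distC (dist_adj xp).2 (dist_adj xy).1 up uy; lia.
have [z [pz yz zle]] := Gmesh u p y py2.
have uz : dist u z = n.+1.
  by have := dist_triangle z u y; rewrite (dist_adj yz).2; lia.
have [q [pq zq uq]] := IHn _ _ pz up uz.
have qx2 : dist q x = 2.
  have := dist_triangle q u x; have := dist_triangle p q x.
  by rewrite (dist_adj pq).2 (dist_adj xp).2; lia.
have qy2 : dist q y = 2.
  have := dist_triangle q u y; have := dist_triangle z q y.
  by rewrite (dist_adj zq).2 (dist_adj yz).2; lia.
have [r [qr yr rle]] := Gmesh x q y qy2.
have ur : dist u r = n.+1.
  have := dist_triangle q u r; have := dist_triangle r u y.
  by rewrite (dist_adj qr).1 (dist_adj yr).2; lia.
exists r; split=> //; rewrite adj_dist.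
have := dist_triangle r u x; move: rle.
by rewrite (dist_adj xy).1 (distC x q) (distC r x); lia.
Qed.

End Distance.

(** * The metric of Johnson graphs *)

Section FsetDistance.
Variable X : choiceType.
Implicit Types A B U : {fset X}.
Local Open Scope fset_scope.

Lemma card_fsetD_sym A B : #|` A| = #|` B| -> #|` A `\` B| = #|` B `\` A|.
Proof. by rewrite -(cardfsID B A) -(cardfsID A B) fsetIC => /addnI. Qed.

Lemma card_fsetD_triangle B A U :
  #|` A `\` U| <= (#|` A `\` B| + #|` B `\` U|)%N.
Proof.
have /fsubset_leq_card : A `\` U `<=` (A `\` B) `|` (B `\` U).
  apply/fsubsetP => x; rewrite !inE.
  by case: (x \in A) (x \in B) (x \in U) => [] [] [].
by move/leq_trans; apply; rewrite -cardfsUI leq_addr.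
Qed.

Lemma card_fsetD_eq0 A B : #|` A| = #|` B| -> #|` A `\` B| = 0 -> A = B.
Proof.
move=> AB /eqP; rewrite cardfs_eq0 fsetD_eq0 => sAB.
by apply/eqP; rewrite eqEfcard sAB AB leqnn.
Qed.

Lemma card_fset1UD a A U : a \notin A ->
  #|` (a |` A) `\` U| = ((a \notin U) + #|` A `\` U|)%N.
Proof.
move=> aA; rewrite fsetDUl; have [aU|aU] := boolP (a \in U).
  have -> : [fset a] `\` U = fset0; last by rewrite fset0U.
  by apply/eqP; rewrite fsetD_eq0 fsub1set.
have -> : [fset a] `\` U = [fset a].
  by apply/fsetP => x; rewrite !inE; case: eqP => [->|]; rewrite ?aU ?andbF.
by rewrite cardfsU1 inE negb_and aA orbT.
Qed.

End FsetDistance.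

Section Johnson.
Variables (X : choiceType) (k : nat).
Implicit Types A B : johnson X k.
Local Open Scope fset_scope.

Lemma card_johnson A : #|` val A| = k.
Proof. exact/eqP/(valP A). Qed.

Lemma adj_johnson A B : adj A B = (#|` val A `\` val B| == 1).
Proof.
rewrite /adj /= /johnson_adj cardfsU.
have -> : (val A `\` val B) `&` (val B `\` val A) = fset0.
  by apply/fsetP => x; rewrite !inE; case: (x \in val A); rewrite ?andbF.
rewrite -card_fsetD_sym ?card_johnson // cardfs0 subn0; lia.
Qed.

(** Each step changes one element, and exchanging an element of A outside B for
    one of B outside A is a step towards B. *)
Lemma dist_johnson A B : dist A B = #|` val A `\` val B|.
Proof.
move: A; apply: dist_unique => [A|A A'|A n].
- split=> [/card_fsetD_eq0 e|->]; last by rewrite fsetDv cardfs0.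
  by apply: val_inj; apply: e; rewrite !card_johnson.
- rewrite adj_johnson => /eqP AA'.
  by rewrite (leq_trans (card_fsetD_triangle (val A') _ _)) ?AA'.
- move=> ABn.
  have [a] : exists a, a \in val A `\` val B.
    by apply/fset0Pn; rewrite -cardfs_gt0 ABn.
  rewrite inE => /andP[aB aA].
  have [b] : exists b, b \in val B `\` val A.
    by apply/fset0Pn; rewrite -cardfs_gt0 -card_fsetD_sym ?card_johnson ?ABn.
  rewrite inE => /andP[bA bB].
  have cA := cardfsD1 a (val A); rewrite aA card_johnson in cA.
  have bAa : b \notin val A `\ a by rewrite !inE (negbTE bA) andbF.
  have cA' : #|` b |` (val A `\ a)| == k.
    by rewrite cardfsU1 bAa; apply/eqP/esym.
  have defA : val A = a |` (val A `\ a) by rewrite fsetD1K.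
  have aAa : a \notin val A `\ a by rewrite !inE eqxx.
  exists (exist (fun A : {fset X} => #|` A| == k) _ cA' : johnson X k).
    rewrite adj_johnson /= {1}defA card_fset1UD // !inE eqxx orbF.
    have -> : val A `\ a `\` (b |` (val A `\ a)) = fset0.
      by apply/eqP; rewrite fsetD_eq0 fsubsetUr.
    by rewrite cardfs0; case: (a =P b) bA => // <-; rewrite aA.
  rewrite /= card_fset1UD // bB; move: ABn.
  by rewrite {1}defA card_fset1UD // aB => -[].
Qed.

End Johnson.

Lemma dist_isomorphic (G H : graph) (f : G -> H) : connected H ->
    bijective f -> (forall x y, adj (f x) (f y) = adj x y) ->
  forall u v, dist u v = dist (f u) (f v).
Proof.
move=> Hconn [g fK gK] f_adj u v; move: u.
apply: dist_unique => [u|u x|u n].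
- by split=> [/(dist_eq0 Hconn) /(can_inj fK)|->]; rewrite ?dist_refl.
- rewrite -f_adj => /(dist_adj Hconn)[ux _].
  by rewrite (leq_trans (dist_triangle Hconn (f x) _ _)) // ux.
- move=> /(dist_closer Hconn)[x ux xv]; exists (g x); last by rewrite gK.
  by rewrite -f_adj gK.
Qed.

(** The form in which the embedding is used. As all sets have the same size,
    this cardinality is half that of the symmetric difference. *)
Lemma partial_johnson_code (G : graph) : partial_johnson G ->
  exists (X : choiceType) (k : nat) (phi : G -> {fset X}),
    (forall x, #|` phi x| = k) /\
    (forall x y, dist x y = #|` (phi x `\` phi y)%fset|).
Proof.
move=> [X [k [H [_ [Hconn Hdist] [f f_bij f_adj]]]]].
exists X, k, (fun x => val (val (f x))); split=> [x|x y].
  exact: card_johnson.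
by rewrite (dist_isomorphic Hconn f_bij) // Hdist dist_johnson.
Qed.

(** * Local convexity of distances in meshed partial Johnson graphs *)

(** Two common neighbours whose average is at least as close to every vertex as
    the average of v and w. Unlike in meshedness, the choice does not depend on
    u, so that the inequality can be summed over the vertices of a profile. The
    two neighbours may coincide. *)
Definition balanced (G : graph) (v w : G) : Prop := exists x y,
  [/\ adj v x /\ adj w x, adj v y /\ adj w y &
   forall u, dist u x + dist u y <= dist u v + dist u w].

Lemma balanced_swap (G : graph) (v w : G) : balanced w v -> balanced v w.
Proof.
move=> [x [y [[wx vx] [wy vy] le]]]; exists x, y; split=> // u.
by rewrite [leqRHS]addnC.
Qed.

Section LocalConvexity.
Variables (G : graph) (X : choiceType) (k : nat) (phi : G -> {fset X}).
Hypothesis Gconn : connected G.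
Hypothesis Gmesh : meshed G.
Hypothesis card_phi : forall x, #|` phi x| = k.
Hypothesis dist_phi : forall x y, dist x y = #|` (phi x `\` phi y)%fset|.
Implicit Types (u v w x y z : G) (C : {fset X}) (a b : X).

Definition adds x C a b : Prop :=
  [/\ a != b, a \notin C, b \notin C & phi x = (a |` (b |` C))%fset].

Lemma addsC x C a b : adds x C a b -> adds x C b a.
Proof. by move=> [ab aC bC e]; split; rewrite // 1?eq_sym // e fsetUCA. Qed.

Lemma mem_adds x C a b p : adds x C a b ->
  (p \in phi x) = [|| p == a, p == b | p \in C].
Proof. by move=> [_ _ _ ->]; rewrite !inE. Qed.

Lemma dist_adds x C a b u : adds x C a b ->
  dist u x = (a \notin phi u) + (b \notin phi u) + #|` (C `\` phi u)%fset|.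
Proof.
move=> [ab aC bC e]; rewrite (distC Gconn) dist_phi e -addnA.
by rewrite !card_fset1UD // !inE negb_or ab.
Qed.

Lemma adds_base x C a b : adds x C a b -> #|` (C `\` phi x)%fset| = 0.
Proof.
move=> [_ _ _ ->]; apply/eqP.
by rewrite cardfs_eq0 fsetD_eq0 fsetUA fsubsetUr.
Qed.

Lemma eq_adds v C p q x a b : adds v C p q ->
    (C `<=` phi x)%fset -> a \in phi x -> b \in phi x ->
    a != b -> a \notin C -> b \notin C ->
  adds x C a b.
Proof.
move=> [pq pC qC ev] Cx ax bx ab aC bC; split=> //; apply/esym/eqP.
rewrite eqEfcard !fsubUset !fsub1set ax bx Cx /= card_phi -(card_phi v) ev.
by rewrite !cardfsU1 !inE !negb_or ab aC bC pq pC qC.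
Qed.

(** The sets of two vertices at distance two: their intersection C has two
    elements less, and their common neighbours in the Johnson graph form the
    4-cycle C + a + b, C + a + b', C + a' + b', C + a' + b. *)
Definition square v w C a a' b b' : Prop :=
  [/\ adds v C a a', adds w C b b', (a \notin phi w) && (a' \notin phi w)
    & (b \notin phi v) && (b' \notin phi v)].

Lemma square_swap v w C a a' b b' :
  square v w C a a' b b' -> square w v C b b' a a'.
Proof. by case. Qed.

Lemma square_flip v w C a a' b b' :
  square v w C a a' b b' -> square v w C a' a b b'.
Proof.
by move=> [cv cw aw bv]; split; rewrite // 1?andbC //; apply: addsC.
Qed.

Lemma square_dist v w C a a' b b' : square v w C a a' b b' -> dist v w = 2.
Proof.
move=> [cv cw _ /andP[bv b'v]]; rewrite (dist_adds v cw) bv b'v.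
by rewrite (adds_base cv).
Qed.

Lemma dist2_square v w : dist v w = 2 -> exists C a a' b b',
  square v w C a a' b b'.
Proof.
have pairP (A B : {fset X}) : #|` (A `\` B)%fset| = 2 -> exists a b,
    [/\ a != b, a \notin B, b \notin B & A = (a |` (b |` (A `&` B)))%fset].
  move=> AB2; have [a aAB] : exists a, a \in (A `\` B)%fset.
    by apply/fset0Pn; rewrite -cardfs_gt0 AB2.
  have := cardfsD1 a (A `\` B)%fset.
  rewrite aAB AB2 => -[/esym/eqP/cardfs1P[b e]].
  have : b \in [fset b]%fset by rewrite inE.
  rewrite -e; move: aAB; rewrite !inE => /andP[aB aA] /and3P[ba bB bA].
  exists a, b; split=> //; first by rewrite eq_sym.
  apply/fsetP => x; have := congr1 (fun S : {fset X} => x \in S) e.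
  rewrite !inE /=.
  have [->|xa] := eqVneq x a; first by rewrite aA.
  by case: (x == b) => /=; case: (x \in A); case: (x \in B).
move=> vw2; have [a [a' [aa' aw a'w ev]]] :=
  pairP _ _ (etrans (esym (dist_phi v w)) vw2).
have wv2 : dist w v = 2 by rewrite (distC Gconn).
have [b [b' [bb' bv b'v ew]]] :=
  pairP _ _ (etrans (esym (dist_phi w v)) wv2).
exists (phi v `&` phi w)%fset, a, a', b, b'.
split; rewrite ?aw ?bv //; split=> //.
- by rewrite inE (negbTE aw) andbF.
- by rewrite inE (negbTE a'w) andbF.
- by rewrite inE (negbTE bv).
- by rewrite inE (negbTE b'v).
- by rewrite {1}ew fsetIC.
Qed.

(** A rewrite rule: with both orientations of each disequality, it evaluates
    membership of a, a', b, b' in the sets C + p + q. *)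
Lemma squareE v w C a a' b b' : square v w C a a' b b' ->
  ((a \in C) = false) * ((a' \in C) = false) *
  ((b \in C) = false) * ((b' \in C) = false) *
  ((a == a') = false) * ((a' == a) = false) *
  ((a == b) = false) * ((b == a) = false) *
  ((a == b') = false) * ((b' == a) = false) *
  ((a' == b) = false) * ((b == a') = false) *
  ((a' == b') = false) * ((b' == a') = false) *
  ((b == b') = false) * ((b' == b) = false).
Proof.
move=> [cv cw /andP[aw a'w] _].
have [/negbTE aa' /negbTE aC /negbTE a'C _] := cv.
have [/negbTE bb' /negbTE bC /negbTE b'C _] := cw.
move: aw a'w; rewrite !(mem_adds _ cw) aC a'C !orbF !negb_or.
move=> /andP[/negbTE ab /negbTE ab'] /andP[/negbTE a'b /negbTE a'b'].
by do !split; rewrite // eq_sym.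
Qed.

Lemma square_adj v w C a a' b b' x : square v w C a a' b b' -> adds x C a b ->
  adj v x /\ adj w x.
Proof.
move=> sq cx; have [cv cw _ _] := sq.
rewrite !(adj_dist Gconn) !(dist_adds _ cx) !(mem_adds _ cv) !(mem_adds _ cw).
by rewrite !(adds_base cv) !(adds_base cw) !(squareE sq) !eqxx.
Qed.

Lemma common_neighbor v w C a a' b b' x :
    square v w C a a' b b' -> adj v x -> adj w x ->
  [\/ adds x C a b, adds x C a b', adds x C a' b | adds x C a' b'].
Proof.
move=> sq; have [cv cw /andP[aw a'w] /andP[bv b'v]] := sq.
move=> vx wx.
have := (dist_adj Gconn vx).2; rewrite (dist_adds _ cv).
have := (dist_adj Gconn wx).2; rewrite (dist_adds _ cw).
have [bb'x|bb'x] := boolP ((b \in phi x) && (b' \in phi x)).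
  (* Then b and b' both lie in x but not in v, against adjacency of v and x. *)
  have /andP[bx b'x] := bb'x.
  have := (dist_adj Gconn vx).2; rewrite dist_phi.
  have /fsubset_leq_card : ([fset b; b'] `<=` phi x `\` phi v)%fset.
    by rewrite fsubUset !fsub1set !inE bv b'v bx b'x.
  by rewrite cardfs2 (squareE sq) => /[swap] ->.
move=> bx ax.
have C0 : #|` (C `\` phi x)%fset| = 0.
  move: bx bb'x; move: (b \in _) (b' \in _) #|` _| => p q c; clear.
  by case: p q => [] []; lia.
have Cx : (C `<=` phi x)%fset by rewrite -fsetD_eq0 -cardfs_eq0 C0.
have addsI := eq_adds cv Cx.
move: ax bx; rewrite C0 !addn0.
have [ax|_] := boolP (a \in phi x);
  have [a'x|_] := boolP (a' \in phi x) => //= _;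
  have [bx|_] := boolP (b \in phi x);
  have [b'x|_] := boolP (b' \in phi x) => //= _.
- by constructor 1; apply: addsI; rewrite ?(squareE sq).
- by constructor 2; apply: addsI; rewrite ?(squareE sq).
- by constructor 3; apply: addsI; rewrite ?(squareE sq).
- by constructor 4; apply: addsI; rewrite ?(squareE sq).
Qed.

(** The heart of the proof. Suppose that C + a + b and C + a + b' are the only
    common neighbours of v and w, and that u contains a' but not a. Meshedness
    seen from u leaves, up to exchanging b and b', only the case where u
    contains b but not b'. Then v, w and x are equally far from u, and the
    triangle condition for w and x gives a neighbour z of both that is closer to
    u; it must be C + b + t with t in u. As C + a' + b is missing and the sets
    containing a are too far from u, meshedness for v and z forces
    p = C + a' + t to be a vertex. But p is adjacent to v and at distance two
    from w, x and y, against meshedness for v and w seen from p. *)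
Lemma adjacent_pair_exchange v w C a a' b b' x y u :
    square v w C a a' b b' -> adds x C a b -> adds y C a b' ->
    (forall z, ~ adds z C a' b) -> (forall z, ~ adds z C a' b') ->
  a' \in phi u -> a \in phi u.
Proof.
move=> sq cx cy na'b na'b' a'u; apply/idPn => au.
wlog [bu b'u] : b b' x y sq cx cy na'b na'b' / b \in phi u /\ b' \notin phi u.
  move=> wl; have [p [vp wp]] := Gmesh u (square_dist sq).
  have [cv cw _ _] := sq.
  rewrite (dist_adds _ cv) (dist_adds _ cw) a'u au /=.
  case: (common_neighbor sq vp wp) => cp; rewrite ?(dist_adds _ cp) ?au.
  - move=> le; apply: (wl b b' x y) => //.
    by move: le; case: (b \in _) (b' \in _) => [] [] /=; lia.
  - move=> le; apply: (wl b' b y x) => //.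
      exact/square_swap/square_flip/square_swap.
    by move: le; case: (b \in _) (b' \in _) => [] [] /=; lia.
  - by case: (na'b p).
  - by case: (na'b' p).
have [cv cw _ _] := sq.
have xw : adj w x by case: (square_adj sq cx).
have ux : dist u x = #|` (C `\` phi u)%fset|.+1.
  by rewrite (dist_adds _ cx) au bu.
have uw : dist u w = #|` (C `\` phi u)%fset|.+1.
  by rewrite (dist_adds _ cw) bu b'u.
have uy : dist u y = #|` (C `\` phi u)%fset|.+2.
  by rewrite (dist_adds _ cy) au b'u.
have [z [wz xz uz]] := meshed_triangle Gconn Gmesh xw uw ux.
have := (dist_adj Gconn wz).2; rewrite (dist_adds _ cw) => dwz.
have := (dist_adj Gconn xz).2; rewrite (dist_adds _ cx) => dxz.
have := dist_triangle Gconn z u y; rewrite uz uy (dist_adds _ cy) => dyz.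
have [Cz az bz b'z] : [/\ #|` (C `\` phi z)%fset| = 0, a \notin phi z,
    b \in phi z & b' \notin phi z].
  move: dwz dxz dyz; move: #|` _| #|` _| (a \in _) (b \in _) (b' \in _).
  by clear=> c d [] [] [] /=; split; lia.
have {}Cz : (C `<=` phi z)%fset by rewrite -fsetD_eq0 -cardfs_eq0 Cz.
have [t tz] : exists t, t \in (phi z `\` (b |` C))%fset.
  apply/fset0Pn; rewrite -cardfs_gt0 cardfsDS ?fsubUset ?fsub1set ?bz //.
  case: cw => bb' bC b'C ew; rewrite (card_phi z) -(card_phi w) ew !cardfsU1.
  by rewrite !inE negb_or bb' bC b'C addnK.
move: tz; rewrite !inE negb_or => /andP[/andP[tb tC] tz].
have cz : adds z C t b by apply: (eq_adds cw); rewrite ?(squareE sq).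
have a'z : a' \notin phi z.
  apply/negP => a'z; apply: (na'b z).
  by apply: (eq_adds cw); rewrite ?(squareE sq).
have tu : t \in phi u.
  apply: contra_eqT uz => tu.
  by rewrite (dist_adds _ cz) bu tu -[X in _ != X]add0n eqn_add2r.
have bt : b' != t by apply: contraNneq b'z => ->.
have sqz : square v z C a a' t b.
  split; rewrite ?az //; rewrite !(mem_adds _ cv) !(squareE sq) !orbF.
  by rewrite (negbTE tC) orbF negb_or; apply/andP; split=> //;
    apply/andP; split; apply: contraTneq tz => ->.
have [p [vp zp]] := Gmesh u (square_dist sqz).
rewrite (dist_adds _ cv) uz au a'u.
case: (common_neighbor sqz vp zp) => cp; rewrite (dist_adds _ cp) ?au.
- by move: #|` _| => c; clear; lia.
- by move: #|` _| => c; clear; lia.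
- move=> _; have dpv := (dist_adj Gconn vp).2.
  have [q [vq wq]] := Gmesh p (square_dist sq).
  rewrite dpv (dist_adds _ cw) !(mem_adds _ cp) (adds_base cp).
  rewrite !(squareE sq) !(squareE sqz) (negbTE bt).
  case: (common_neighbor sq vq wq) => cq;
    rewrite ?(dist_adds _ cq) ?(adds_base cp) ?(mem_adds _ cp);
    rewrite ?(squareE sq) ?(squareE sqz) ?(negbTE bt) //.
  + by move/na'b: cq.
  + by move/na'b': cq.
- by move/na'b: cp.
Qed.

(** Each of a, a', b, b' is added once by v and w together, and once by x and y
    together; hence equality in the balance. *)
Lemma balanced_opposite v w C a a' b b' x y :
    square v w C a a' b b' -> adds x C a b -> adds y C a' b' -> balanced v w.
Proof.
move=> sq cx cy; exists x, y; split.
- exact: (square_adj sq cx).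
- have sq' := square_flip (square_swap (square_flip (square_swap sq))).
  exact: (square_adj sq' cy).
- move=> u; have [cv cw _ _] := sq.
  rewrite (dist_adds _ cx) (dist_adds _ cy) (dist_adds _ cv) (dist_adds _ cw).
  lia.
Qed.

(** Here x and y add a twice and a' never, while v and w add each of them once;
    so the balance at u amounts to a being in u whenever a' is. *)
Lemma balanced_adjacent v w C a a' b b' x y :
    square v w C a a' b b' -> adds x C a b -> adds y C a b' ->
    (forall z, ~ adds z C a' b) -> (forall z, ~ adds z C a' b') ->
  balanced v w.
Proof.
move=> sq cx cy na'b na'b'; exists x, y; split.
- exact: (square_adj sq cx).
- exact: (square_adj (square_swap (square_flip (square_swap sq))) cy).
- move=> u; have [cv cw _ _] := sq.
  have := @adjacent_pair_exchange _ _ _ _ _ _ _ _ _ u sq cx cy na'b na'b'.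
  rewrite (dist_adds _ cx) (dist_adds _ cy) (dist_adds _ cv) (dist_adds _ cw).
  by case: (a \in _) (a' \in _) => [] [] /= imp; try lia; have := imp isT.
Qed.

Lemma dist2_balanced v w : dist v w = 2 -> balanced v w.
Proof.
move=> vw2; have [C [a [a' [b [b' sq]]]]] := dist2_square vw2.
have [x [vx wx _]] := Gmesh v vw2.
wlog cx : a a' b b' sq / adds x C a b.
  move=> wl; have sq' := square_swap (square_flip (square_swap sq)).
  case: (common_neighbor sq vx wx) => cx.
  - exact: wl sq cx.
  - exact: wl sq' cx.
  - exact: wl (square_flip sq) cx.
  - exact: wl (square_flip sq') cx.
have sq' := square_swap (square_flip (square_swap sq)).
have [[y cy]|na'b'] := pselect (exists y, adds y C a' b').
  exact: balanced_opposite sq cx cy.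
have [[y cy]|nab'] := pselect (exists y, adds y C a b').
  have [[z cz]|na'b] := pselect (exists z, adds z C a' b).
    exact: balanced_opposite sq' cy cz.
  apply: (balanced_adjacent sq cx cy) => z cz; first by apply: na'b; exists z.
  by apply: na'b'; exists z.
have [[y cy]|na'b] := pselect (exists y, adds y C a' b).
  apply/balanced_swap.
  apply: (balanced_adjacent (square_swap sq) (addsC cx) (addsC cy)) =>
    z /addsC cz.
    by apply: nab'; exists z.
  by apply: na'b'; exists z.
(* The vertex x is the only common neighbour, hence the one that meshedness
   provides for every u. *)
exists x, x; split=> // u; have [y [vy wy le]] := Gmesh u vw2.
have -> : x = y; last by lia.
case: (common_neighbor sq vy wy) => cy.
- apply: (dist_eq0 Gconn); rewrite dist_phi.
  by case: cx cy => _ _ _ -> [_ _ _ ->]; rewrite fsetDv cardfs0.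
- by case: nab'; exists y.
- by case: na'b; exists y.
- by case: na'b'; exists y.
Qed.

End LocalConvexity.

(** * Medians *)

Section Medians.
Variables (R : realType) (G : graph).
Hypothesis Gconn : connected G.
Implicit Types (pi : G -> R) (u v w x y z : G).
Local Open Scope ring_scope.

Lemma F_fset pi (A : {fset G}) x : (forall u, u \notin A -> pi u = 0) ->
  F pi x = \sum_(u <- A) pi u * (dist u x)%:R.
Proof. by move=> piA; apply: fsbigTE => u /piA ->; rewrite mul0r. Qed.

Lemma profile_support pi : profile pi ->
  exists A : {fset G}, forall u, u \notin A -> pi u = 0.
Proof.
move=> [_ /finite_fsetP[A defA]]; exists A => u uA.
apply/eqP; apply: contraNT uA => piu.
by have : [set u | pi u != 0]%classic u by []; rewrite defA.
Qed.

(** A bounded set of vertices may be infinite. But F depends only on the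
    distances to the finitely many vertices of the support, so it takes finitely
    many values on such a set. *)
Lemma F_min_bounded pi (P : G -> Prop) v n x0 : profile pi ->
    P x0 -> (forall x, P x -> (dist v x <= n)%N) ->
  exists2 x, P x & forall y, P y -> F pi x <= F pi y.
Proof.
move=> /profile_support[A piA] Px0 Pn.
pose m := (\max_(u : A) dist (val u) v + n)%N.
pose dists x : {ffun A -> 'I_m.+1} := [ffun u => inord (dist (val u) x)].
pose value (c : {ffun A -> 'I_m.+1}) := \sum_(u : A) pi (val u) * (c u)%:R.
have Fvalue x : P x -> F pi x = value (dists x).
  move=> Px; rewrite (F_fset _ piA) big_seq_fsetE /=; apply: eq_bigr => u _.
  rewrite ffunE inordK // ltnS (leq_trans (dist_triangle Gconn v _ _)) //.
  rewrite leq_add ?Pn //; exact: leq_bigmax.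
pose Q c := `[< exists2 x, P x & dists x = c >].
have Q0 : Q (dists x0) by apply/asboolP; exists x0.
case: (Order.TotalTheory.arg_minP value Q0) => c /asboolP[x Px <-] cmin.
exists x => // y Py; rewrite !Fvalue //; apply: cmin.
by apply/asboolP; exists y.
Qed.

(** Local convexity propagates to arbitrary distances. Take for p the neighbour
    of v towards w of smallest value, and by induction a neighbour q of p
    towards w; the midpoint inequality for v and q yields a competitor of p. *)
Lemma F_convex_step pi v w n : profile pi ->
    (forall v w, dist v w = 2%N -> balanced v w) -> dist v w = n.+1 ->
  exists p, [/\ adj v p, dist p w = n &
     n.+1%:R * F pi p <= n%:R * F pi v + F pi w].
Proof.
move=> pi_prof bal; have [A piA] := profile_support pi_prof.
elim: n v => [|n IHn] v vw.
  have [p vp pw] := dist_closer Gconn vw; exists p; split=> //.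
  by rewrite (dist_eq0 Gconn pw) mul0r mul1r add0r.
pose P p := adj v p /\ dist p w = n.+1.
have [p0 vp0 p0w] := dist_closer Gconn vw.
have [||p [vp pw] pmin] := @F_min_bounded pi P v 1 p0 pi_prof.
- by split.
- by move=> x [/(dist_adj Gconn)[-> _]].
exists p; split=> //.
have [q [pq qw le_q]] := IHn _ pw.
have vq : dist v q = 2%N.
  have := dist_triangle Gconn p v q; have := dist_triangle Gconn q v w.
  by rewrite (dist_adj Gconn vp).1 (dist_adj Gconn pq).1; lia.
have towards x : adj v x -> adj q x -> F pi p <= F pi x.
  move=> vx qx; apply: pmin; split=> //.
  have := dist_triangle Gconn x v w; have := dist_triangle Gconn q x w.
  by rewrite (dist_adj Gconn vx).1 (dist_adj Gconn qx).2; lia.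
have [x [y [[vx qx] [vy qy] le]]] := bal _ _ vq.
have Fle : F pi x + F pi y <= F pi v + F pi q.
  rewrite !(F_fset _ piA) -!big_split /=; apply: ler_sum => u _.
  by rewrite -!mulrDr ler_wpM2l ?pi_prof.1 // -!natrD ler_nat.
have px := towards _ vx qx; have py := towards _ vy qy.
have n1 : 0 <= n.+1%:R :> R by [].
have mid : n.+1%:R * (F pi p + F pi p) <= n.+1%:R * (F pi v + F pi q).
  by rewrite ler_wpM2l // (le_trans _ Fle) // lerD.
rewrite -[n.+2]addn1 -addn1 !natrD in le_q mid *.
move: (n%:R) (F pi p) (F pi q) (F pi v) (F pi w) le_q mid.
by clear=> m fp fq fv fw; lra.
Qed.

(** When v and w are both medians, the step from v towards w stays inside the
    set of medians. *)
Lemma balanced_connected_medians :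
  (forall v w, dist v w = 2%N -> balanced v w) -> connected_medians R G.
Proof.
move=> bal pi pi_prof v w.
move: {2}(dist _ _) (erefl (dist (val v) (val w))) => n.
elim: n v => [|n IHn] v vw.
  by exists [::]; split=> //=; apply/val_inj/(dist_eq0 Gconn).
have [p [vp pw le_p]] := F_convex_step pi_prof bal vw.
have medF y : F pi (val w) <= F pi y := set_mem (valP w) y.
have vw_eq : F pi (val v) = F pi (val w).
  by apply/eqP; rewrite eq_le medF andbT; exact: (set_mem (valP v)).
have le_pw : F pi p <= F pi (val w).
  by move: le_p; rewrite vw_eq -{2}[F pi (val w)]mul1r -mulrDl natr1 ler_pM2l.
have p_med : p \in Med pi.
  by rewrite inE => y; apply: le_trans le_pw (medF y).
have [s [ps sw]] := IHn (exist _ p p_med) pw.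
by exists (exist _ p p_med :: s); split; rewrite //= ps andbT.
Qed.

Lemma sum_point_mass (A : {fset G}) v (c : R) (f : G -> R) : v \in A ->
  \sum_(z <- A) c *+ (z == v) * f z = c * f v.
Proof.
move=> vA; rewrite (bigD1_seq v) //= eqxx mulr1n big1 ?addr0 // => z zv.
by rewrite (negbTE zv) mulr0n mul0r.
Qed.

(** If no common neighbour of v and w satisfies the inequality for u, a profile
    has the two non-adjacent vertices v and w as its only medians. The large
    mass M on v and w confines the medians to the interval between them; the
    masses added to M give v and w the same value, and the mass 2 on u makes the
    value of a common neighbour x exceed it by 2 d(u,x) - d(u,v) - d(u,w). *)
Lemma connected_medians_meshed : connected_medians R G -> meshed G.
Proof.
move=> med_conn u v w vw2; apply: contrapT => no_x.
pose a := dist u v; pose b := dist u w; pose M := (2 * a + 2 * b + 1)%N.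
pose pi z : R :=
  (M + a)%:R *+ (z == v) + (M + b)%:R *+ (z == w) + 2 *+ (z == u).
pose N y := ((M + a) * dist v y + (M + b) * dist w y + 2 * dist u y)%N.
have pi_supp z : z \notin [fset u; v; w]%fset -> pi z = 0.
  rewrite !inE /pi !negb_or => /andP[/andP[/negbTE -> /negbTE ->] /negbTE ->].
  by rewrite !mulr0n !addr0.
have FN y : F pi y = (N y)%:R.
  rewrite (F_fset _ pi_supp) /pi.
  under eq_bigr do rewrite !mulrDl.
  rewrite !big_split /= !sum_point_mass ?inE ?eqxx ?orbT //.
  (* The first arguments keep natrD from splitting the two masses. *)
  by rewrite /N (natrD _ (_ * _ + _ * _)%N) (natrD _ (_ * _)%N) !natrM.
have wv2 : dist w v = 2%N by rewrite distC.
have Nv : N v = (2 * M + 2 * a + 2 * b)%N.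
  by rewrite /N dist_refl wv2 -/a; clear; lia.
have Nw : N w = N v.
  by rewrite Nv /N dist_refl vw2 -/b; clear; lia.
have Ngt y : y <> v -> y <> w -> (N v < N y)%N.
  move=> yv yw; rewrite Nv /N.
  have vy0 : (0 < dist v y)%N.
    by rewrite lt0n; apply/eqP => /(dist_eq0 Gconn) vy; apply: yv.
  have wy0 : (0 < dist w y)%N.
    by rewrite lt0n; apply/eqP => /(dist_eq0 Gconn) wy; apply: yw.
  have [vwy|vwy] := leqP (dist v y + dist w y) 2.
    have [vy wy] : dist v y = 1%N /\ dist w y = 1%N.
      by move: vy0 wy0 vwy; clear; lia.
    rewrite vy wy; have : ~ (2 * dist u y <= a + b)%N.
      by move=> le; apply: no_x; exists y; rewrite !(adj_dist Gconn) vy wy.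
    by clear; lia.
  have : (M * 3 <= M * (dist v y + dist w y))%N by rewrite leq_mul2l vwy orbT.
  have : (2 * a + 2 * b < M)%N by rewrite /M addn1.
  by rewrite mulnDr !mulnDl; clear; lia.
have vmed : v \in Med pi.
  rewrite inE => y; rewrite !FN ler_nat.
  have [->//|yv] := eqVneq y v; have [->|yw] := eqVneq y w; first by rewrite Nw.
  by apply/ltnW/Ngt; apply/eqP.
have wmed : w \in Med pi.
  by rewrite inE => y; rewrite FN Nw -FN; exact: (set_mem vmed).
have pi_prof : profile pi.
  split=> [z|]; first by rewrite !addr_ge0 // mulrn_wge0.
  apply/finite_fsetP; exists [fset z in [fset u; v; w]%fset | pi z != 0]%fset.
  apply/seteqP; split=> z /=; rewrite !inE; last by case/andP.
  move=> piz; rewrite piz andbT; apply: contraNT piz => zA.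
  by rewrite pi_supp // !inE.
have [[|x s] []] := med_conn pi pi_prof (exist _ v vmed) (exist _ w wmed).
  by move=> _ /(congr1 val) /= vw; rewrite vw dist_refl in vw2.
move=> /= /andP[vx _] _.
have := set_mem (valP x) v; rewrite !FN ler_nat leqNgt => /negP; apply.
apply: Ngt => xE; move: vx; rewrite /= /induced_adj /= xE ?adj_irr //.
by rewrite (adj_dist Gconn) vw2.
Qed.

End Medians.

Theorem theorem66 (R : realType) (G : graph) (Gconn : connected G)
    (GJ : partial_johnson G) :
  connected_medians R G <-> meshed G.
Proof.
split=> [|Gmesh]; first exact: connected_medians_meshed.
have [X [k [phi [card_phi dist_phi]]]] := partial_johnson_code GJ.
apply: (balanced_connected_medians Gconn) => v w.
exact: (dist2_balanced Gconn Gmesh card_phi dist_phi).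
Qed.
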